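(* Let $f:2^V\to\mathbb{R}_{\ge0}$ be monotone, normalized and submodular, let $\mathcal{M}$ be a matroid on $V$ of rank $k$, and consider any stream of elements of $V$. Let $\operatorname{OPT}$ be the maximum value of $f$ over independent subsets of the stream elements. For any $\varepsilon>0$ and any threshold $\tau<\operatorname{OPT}$, the output $S$ of \textsc{Threshold-Swapping} with parameters $(k,\varepsilon,\tau)$ satisfies $\operatorname{OPT}\le(4+O(\varepsilon))f(S)$.
   Context: $f(X\mid Y)=f(X\cup Y)-f(Y)$; $X+e=X\cup\{e\}$, $X-e=X\setminus\{e\}$. Algorithm \textsc{Threshold-Swapping}$(k,\varepsilon,\tau)$: initialize $S\gets\emptyset$, $S'\gets\emptyset$. For each arriving element $e$: set $w(e)\gets f(e\mid S')$. If $w(e)<\frac{\varepsilon}{k}\tau$, ignore $e$. Otherwise, if $S+e\in\mathcal{M}$, set $S\gets S+e$, $S'\gets S'+e$; else let $s_e\in\arg\min\{w(y):y\in S,\ S-y+e\in\mathcal{M}\}$ (ties broken consistently) and, if $2w(s_e)<w(e)$, set $S\gets S-s_e+e$, $S'\gets S'+e$. Return $S$.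
   Formalization: The formal version requires ε < 1 and that the stream elements be pairwise distinct (each element arrives once), since the claim fails for ε ≥ 1 and when a repeated arrival resets the weight of a kept element. *)

(* Defs.v *)
From HB Require Import structures.
From mathcomp Require Import all_boot all_order all_algebra.
From mathcomp Require Import all_classical all_reals all_analysis.
Set Implicit Arguments.
Unset Strict Implicit.
Unset Printing Implicit Defensive.
Import Order.TTheory GRing.Theory Num.Theory.
Import numFieldNormedType.Exports.
Local Open Scope ring_scope.

Record matroid (V : finType) := Matroid {
  indep : {set {set V}};
  indep_set0 : finset.set0 \in indep;
  indep_subset : forall A B : {set V},
    A \subset B -> B \in indep -> A \in indep;
  indep_augment : forall A B : {set V},
    A \in indep -> B \in indep -> (#|A| < #|B|)%N ->
    exists2 x, x \in B :\: A & x |: A \in indep }.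

Definition mrank (V : finType) (M : matroid V) : nat :=
  (\max_(A in indep M) #|A|)%N.

Section SetFunctions.
Variables (R : realType) (V : finType).
Implicit Types (f : {set V} -> R) (A B : {set V}).

Definition set_nonnegative f := forall A, 0 <= f A.

Definition set_monotone f := forall A B, A \subset B -> f A <= f B.

Definition set_normalized f := f finset.set0 = 0.

Definition submodular f :=
  forall A B, f (A :|: B) + f (A :&: B) <= f A + f B.

Definition marginal f A B : R := f (A :|: B) - f B.

(* The default value is itself attained, at the independent set [set0], so
   this is the maximum of [f] over the independent sets of stream elements. *)
Definition opt f (M : matroid V) (s : seq V) : R :=
  \big[Num.max/f finset.set0]_(A in indep M | A \subset [set x in s]) f A.

End SetFunctions.

(* A fixed rule selecting one element out of each nonempty set of tied
   minimizers. *)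
Definition tie_breaking (V : finType) (tb : {set V} -> option V) :=
  forall A : {set V}, if tb A is Some y then y \in A else A == finset.set0.

Section ThresholdSwapping.
Variables (R : realType) (V : finType).
Variables (f : {set V} -> R) (M : matroid V) (tb : {set V} -> option V).
Variables (k : nat) (eps tau : R).

Record state := State {
  sol : {set V};
  hist : {set V};
  wgt : V -> R }.

(* The weights are only read on elements of [sol], all of which have arrived;
   their initial value is irrelevant. *)
Definition init_state : state := State finset.set0 finset.set0 (fun=> 0).

Definition swap_candidates (S : {set V}) (e : V) : {set V} :=
  [set y in S | e |: (S :\ y) \in indep M].

Definition argmin_set (w : V -> R) (A : {set V}) : {set V} :=
  [set y in A | [forall z in A, w y <= w z]].

(* The last branch is reached when no element of [S] can be exchanged for [e],
   that is, when [e] is a loop of [M]; then [e] is discarded. *)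
Definition step (st : state) (e : V) : state :=
  let S := sol st in
  let S' := hist st in
  let w := fun x => if x == e then marginal f [set e] S' else wgt st x in
  if w e < eps / k%:R * tau then State S S' w
  else if e |: S \in indep M then State (e |: S) (e |: S') w
  else if tb (argmin_set w (swap_candidates S e)) is Some y then
    if 2 * w y < w e then State (e |: (S :\ y)) (e |: S') w
    else State S S' w
  else State S S' w.

Definition threshold_swapping (s : seq V) : {set V} :=
  sol (foldl step init_state s).

End ThresholdSwapping.

(* Main.v *)
(** Write [w] for the weights, [S] for the current solution and [H] for the set
of all elements ever accepted. Submodularity gives [w(S) <= f S], and since an
accepted element is worth at least twice the element it evicts,
[f H = w(H) <= 2 w(S)]. For every [t] the span of [{y in S | w y >= t}] only
grows, because a swap evicts the lightest element of a circuit; and an element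
[x] rejected by the swap rule lies in that span as soon as [2 t <= w x]. Hence,
for an independent set [O], the swap-rejected part of [O] has at most
[#|{y in S | w y >= t}|] elements of weight at least [2 t], for every [t], so
its total weight is at most [2 w(S)]. The elements of [O] rejected by the
threshold weigh at most [eps * tau] in total. Therefore
[f O <= f H + w(O \ H) <= 4 w(S) + eps * OPT], and
[4 / (1 - eps) = 4 + 4 eps / (1 - eps)]. *)

Require Import Defs.
From HB Require Import structures.
From mathcomp Require Import all_boot all_order all_algebra.
From mathcomp Require Import all_classical all_reals all_analysis.
From mathcomp Require Import fintype finset ring lra.
Set Implicit Arguments.
Unset Strict Implicit.
Unset Printing Implicit Defensive.
Import Order.TTheory GRing.Theory Num.Theory.
Import numFieldNormedType.Exports.
Local Open Scope ring_scope.

Lemma finset_ind (V : finType) (P : {set V} -> Prop) :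
  P set0 -> (forall x (A : {set V}), x \notin A -> P A -> P (x |: A)) -> forall A, P A.
Proof.
move=> P0 PU A; have [n] := ubnP #|A|; elim: n A => // n IH A.
have [-> //|[x xA]] := set_0Vmem A.
rewrite ltnS (cardsD1 x) xA => ltAn; rewrite -(setD1K xA).
by apply: PU; [rewrite !inE eqxx | exact: IH].
Qed.

(** * Span and exchange in a matroid *)

Section Span.
Variables (V : finType) (M : matroid V).
Implicit Types (x e y : V) (A B I J S : {set V}).

(** For independent [I] this is membership of [x] in the closure of [I]. *)
Definition spanned I x := (x \in I) || (x |: I \notin indep M).

Lemma indep_extend A B : A \in indep M -> B \in indep M -> (#|A| <= #|B|)%N ->
  exists K, [/\ K \in indep M, A \subset K, K \subset A :|: B & #|K| = #|B|].
Proof.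
move=> iA iB; move dE: (#|B| - #|A|)%N => d.
elim: d A iA dE => [|d IH] A iA dE leAB.
  exists A; split=> //; first exact: subsetUl.
  by apply/eqP; rewrite eqn_leq leAB -subn_eq0 dE eqxx.
have ltAB : (#|A| < #|B|)%N by rewrite -subn_gt0 dE.
have [x] := indep_augment iA iB ltAB; rewrite inE => /andP[xA xB] iU.
have cU : #|x |: A| = #|A|.+1 by rewrite cardsU1 xA.
have [||K [iK sK sKU cK]] := IH _ iU; rewrite ?cU ?subnS ?dE //.
exists K; split=> //; first exact: subset_trans (subsetUr _ _) sK.
apply: subset_trans sKU _; rewrite !subUset subsetUl subsetUr.
by rewrite sub1set inE xB orbT.
Qed.

Lemma spanned_card I J : I \in indep M -> J \in indep M ->
  {in I, forall x, spanned J x} -> (#|I| <= #|J|)%N.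
Proof.
move=> iI iJ spIJ; rewrite leqNgt; apply/negP => ltJI.
have [x] := indep_augment iJ iI ltJI; rewrite inE => /andP[xJ xI] iU.
by have := spIJ x xI; rewrite /spanned (negbTE xJ) iU.
Qed.

(** If [x] were outside [J] with [x |: J] independent, [I] would extend inside [I :|: (x |: J)] to
    an independent [K] of size [#|J| + 1]. Such a [K] avoids [x], so augmenting [J] from [K] adds an
    element of [I], although [J] spans [I]. *)
Lemma spanned_trans I J x : I \in indep M -> J \in indep M ->
  {in I, forall y, spanned J y} -> spanned I x -> spanned J x.
Proof.
move=> iI iJ spIJ /orP[/spIJ //|dxI]; apply/negPn/negP.
rewrite /spanned negb_or negbK => /andP[xJ iU].
have leIU : (#|I| <= #|x |: J|)%N.
  by rewrite (leq_trans (spanned_card iI iJ spIJ)) ?subset_leq_card ?subsetUr.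
have [K [iK sIK sKU cK]] := indep_extend iI iU leIU.
have xK : x \notin K.
  apply: contra dxI => xK; apply: indep_subset iK.
  by rewrite subUset sub1set xK.
have ltJK : (#|J| < #|K|)%N by rewrite cK cardsU1 xJ.
have [y] := indep_augment iJ iK ltJK; rewrite inE => /andP[yJ yK] iyJ.
have := subsetP sKU _ yK; rewrite !inE (negbTE yJ) orbF => /orP[yI|/eqP yx].
  by have := spIJ y yI; rewrite /spanned (negbTE yJ) iyJ.
by rewrite -yx yK in xK.
Qed.

(* The exchangeable elements together with [e] contain the fundamental circuit
   of [e] in [S]. *)
Lemma swap_candidates_spanned S I e : S \in indep M -> e |: S \notin indep M ->
  I \subset S -> swap_candidates M S e \subset I -> e |: I \notin indep M.
Proof.
move=> iS dS sIS sCI; apply/negP => iU.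
have eS : e \notin S by apply: contra dS => eS; rewrite (setUidPr _) ?sub1set.
have eI : e \notin I by apply: contra eS; exact: subsetP.
have ltIS : (#|e |: I| <= #|S|)%N.
  rewrite cardsU1 eI; apply: proper_card; rewrite properEneq sIS andbT.
  by apply: contra dS => /eqP <-.
(* [K] has the size of [S] and misses some [y] in [S], so [K] is [S] with [y] exchanged for [e].
   Then [y] is a candidate, hence lies in [I] and in [K], a contradiction. *)
have [K [iK sK sKU cK]] := indep_extend iU iS ltIS.
have eK : e \in K by apply: (subsetP sK); rewrite !inE eqxx.
have /subsetPn[y yS yK] : ~~ (S \subset K).
  apply: contra dS => sSK; apply: indep_subset iK.
  by rewrite subUset sub1set eK.
have sKe : K \subset e |: (S :\ y).
  apply/subsetP => z zK; have := subsetP sKU z zK; rewrite !inE.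
  have -> : z != y by apply: contraNneq yK => <-.
  by case/orP => [/orP[->//|/(subsetP sIS) ->]|->]; rewrite orbT.
have yC : y \in swap_candidates M S e.
  rewrite inE yS; suff <- : K = e |: (S :\ y) by [].
  apply/eqP; rewrite eqEcard sKe cK cardsU1 (cardsD1 y S) yS.
  by rewrite leq_add2r leq_b1.
by move: yK; rewrite (subsetP sK) // !inE (subsetP sCI _ yC) orbT.
Qed.

Lemma indep_card_le_mrank A : A \in indep M -> (#|A| <= mrank M)%N.
Proof. by move=> iA; apply: (leq_bigmax_cond (F := fun A : {set V} => #|A|)). Qed.

End Span.

(** * Sums compared through level sets, and marginals of a submodular function *)

Section Sums.
Variables (R : realType) (V : finType).

(** Greedy matching: a heaviest [a] in [A] is paired with some [b] in [B] such that [u a <= v b],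
    and both are removed. Levels up to [u a] lose one element on each side; above [u a] the level of
    [A] is empty. *)
Lemma sum_le_of_level_card (u v : V -> R) (A B : {set V}) :
  {in B, forall b, 0 <= v b} ->
  (forall t, (#|[set a in A | (t <= u a)%R]| <= #|[set b in B | (t <= v b)%R]|)%N) ->
  \sum_(a in A) u a <= \sum_(b in B) v b.
Proof.
have [n] := ubnP #|A|; elim: n A B => // n IH A B ltAn v0 level.
have [->|[a0 a0A]] := set_0Vmem A.
  by rewrite big_set0; apply: sumr_ge0.
have [a aA amax] : exists2 a, a \in A & {in A, forall x, u x <= u a}.
  by case: (arg_maxP u a0A) => a aA amax; exists a.
have : (0 < #|[set b in B | (u a <= v b)%R]|)%N.
  by apply: leq_trans (level _); apply/card_gt0P; exists a; rewrite inE aA lexx.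
move=> /card_gt0P[b]; rewrite inE => /andP[bB leuv].
rewrite (big_setD1 _ aA) (big_setD1 _ bB) /=; apply: lerD => //.
have subE (h : V -> R) (C : {set V}) x t :
    [set y in C :\ x | t <= h y] = [set y in C | t <= h y] :\ x.
  by apply/setP => y; rewrite !inE andbA.
apply: IH => [|y|t].
- by move: ltAn; rewrite (cardsD1 a) aA.
- by rewrite inE => /andP[_]; exact: v0.
rewrite !subE; have [leta|ltat] := leP t (u a).
  have := level t; rewrite (cardsD1 a) [in X in (_ <= X)%N](cardsD1 b).
  by rewrite !inE aA bB leta (le_trans leta leuv) !add1n ltnS.
rewrite (_ : [set y in A | t <= u y] = set0) ?set0D ?cards0 //.
apply/setP => y; rewrite !inE; apply/negbTE/negP => /andP[yA].
by move=> /(lt_le_trans ltat); rewrite ltNge; have -> := amax y yA.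
Qed.

Variable f : {set V} -> R.
Hypotheses (fM : set_monotone f) (fS : submodular f).

Lemma marginal_ge0 A B : 0 <= marginal f A B.
Proof. by rewrite /marginal subr_ge0; apply: fM; apply: subsetUr. Qed.

Lemma marginal1_antimono x (A B : {set V}) : A \subset B -> x \notin B ->
  marginal f [set x] B <= marginal f [set x] A.
Proof.
move=> sAB xB; rewrite /marginal.
have := fS (x |: A) B; rewrite -setUA (setUidPr sAB).
rewrite (_ : (x |: A) :&: B = A); first by lra.
rewrite setIUl (setIidPl sAB) (_ : [set x] :&: B = set0) ?set0U //.
by apply/setP => y; rewrite !inE; case: eqP => // ->; rewrite (negbTE xB).
Qed.

(** When the elements of [A] join [B] one at a time, each gains at most its marginal over [B]. *)
Lemma setU_le_sum_marginal (A B : {set V}) :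
  f (A :|: B) <= f B + \sum_(x in A) marginal f [set x] B.
Proof.
elim/finset_ind: A => [|x A xA IH]; first by rewrite set0U big_set0 addr0.
rewrite big_setU1 //= addrCA -setUA.
suff : f (x |: (A :|: B)) - f (A :|: B) <= marginal f [set x] B by lra.
have [xB|xB] := boolP (x \in A :|: B).
  by rewrite (setUidPr _) ?sub1set // subrr marginal_ge0.
by apply: marginal1_antimono; rewrite ?subsetUr.
Qed.

End Sums.

(** * The loop invariant and its preservation *)

Definition update (R : realType) (V : finType) (w : V -> R) (e : V) (a : R) :
    V -> R :=
  fun x => if x == e then a else w x.

Definition level (R : realType) (V : finType) (w : V -> R) (S : {set V})
    (t : R) : {set V} :=
  [set y in S | t <= w y].

Section Algorithm.
Variables (R : realType) (V : finType) (f : {set V} -> R) (M : matroid V).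
Variables (tb : {set V} -> option V) (k : nat) (eps tau : R).
Hypotheses (fM : set_monotone f) (f0 : set_normalized f) (fS : submodular f).
Hypothesis tbP : tie_breaking tb.
Implicit Types (p S H A : {set V}) (w : V -> R) (e x y : V) (st : state R V).

Lemma level_subset w S t : level w S t \subset S.
Proof. by apply/subsetP => x; rewrite inE => /andP[]. Qed.

Lemma update_sum w e a A : e \notin A ->
  \sum_(x in A) update w e a x = \sum_(x in A) w x.
Proof.
move=> eA; apply: eq_bigr => x xA; rewrite /update.
by case: eqP => // xe; rewrite -xe xA in eA.
Qed.

Lemma update_level w e a S t : e \notin S -> level (update w e a) S t = level w S t.
Proof.
move=> eS; apply/setP => x; rewrite !inE /update.
by case: (eqVneq x e) => // ->; rewrite (negbTE eS).
Qed.

(** The second alternative records a failed swap through spans of level sets: these only grow, so it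
    survives later swaps. The factor 2 is that of the swap test. *)
Definition rejected_by w S x :=
  w x < eps / k%:R * tau \/
  forall t, 2 * t <= w x -> spanned M (level w S t) x.

(** [p] is the set of elements that have arrived. [inv_wgt] ranges over all subsets of the history,
    so evictions do not affect it. [inv_marginal] persists because weights are frozen at arrival
    while marginals over the growing history decrease. *)
Record invariant p st : Prop := Invariant {
  inv_indep : sol st \in indep M;
  inv_sol : sol st \subset hist st;
  inv_hist : hist st \subset p;
  inv_ge0 : forall x, 0 <= wgt st x;
  inv_wgt : forall A, A \subset hist st -> \sum_(x in A) wgt st x <= f A;
  inv_hist_le : f (hist st) <= 2 * \sum_(x in sol st) wgt st x;
  inv_marginal : forall x, x \in p :\: hist st ->
    marginal f [set x] (hist st) <= wgt st x;
  inv_rejected : forall x, x \in p :\: hist st ->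
    rejected_by (wgt st) (sol st) x }.

Lemma invariant_init : invariant set0 (init_state R V).
Proof.
split => //=; rewrite ?indep_set0 ?sub0set //.
- by move=> A; rewrite subset0 => /eqP ->; rewrite big_set0 f0.
- by rewrite big_set0 f0 mulr0.
- by move=> x; rewrite !inE.
- by move=> x; rewrite !inE.
Qed.

Lemma invariant_reject p st e : invariant p st -> e \notin p ->
  let w := update (wgt st) e (marginal f [set e] (hist st)) in
  rejected_by w (sol st) e -> invariant (e |: p) (State (sol st) (hist st) w).
Proof.
move=> [iS sSH sHp w0 wA HS marg rej] ep w rejw.
have eH : e \notin hist st by apply: contra ep; exact: subsetP.
have eS : e \notin sol st by apply: contra eH; exact: subsetP.
have wE x : x != e -> w x = wgt st x by rewrite /w /update => /negbTE ->.
split => //=.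
- exact: subset_trans sHp (subsetUr _ _).
- by move=> x; rewrite /w /update; case: ifP; rewrite ?marginal_ge0.
- move=> A sAH; rewrite update_sum ?wA //; apply: contra eH; exact: subsetP.
- by rewrite update_sum.
- move=> x; rewrite !inE => /andP[xH]; case: eqVneq => [->|xe] //= xp.
    by rewrite /w /update eqxx.
  by rewrite wE //; apply: marg; rewrite inE xH.
- move=> x; rewrite !inE => /andP[xH]; case: eqVneq => [->|xe] //= xp.
  have [lt|sp] : rejected_by (wgt st) (sol st) x by apply: rej; rewrite inE xH.
    by left; rewrite wE.
  by right=> t; rewrite wE // update_level //; exact: sp.
Qed.

(** Shared by insertion and swap. The value of the history grows by exactly [m], which the weight
    hypothesis pays for; the hypothesis on levels and transitivity of span preserve past
    rejections. *)
Lemma invariant_accept p st e S : invariant p st -> e \notin p ->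
  let m := marginal f [set e] (hist st) in
  let w := update (wgt st) e m in
  S \in indep M -> S \subset e |: hist st ->
  m + 2 * \sum_(x in sol st) wgt st x <= 2 * \sum_(x in S) w x ->
  (forall t x, x \in level (wgt st) (sol st) t -> spanned M (level w S t) x) ->
  invariant (e |: p) (State S (e |: hist st) w).
Proof.
move=> [iS sSH sHp w0 wA HS marg rej] ep m w iS1 sS1 wS1 sp1.
have eH : e \notin hist st by apply: contra ep; exact: subsetP.
have wE x : x != e -> w x = wgt st x by rewrite /w /update => /negbTE ->.
have rejP x : x \in (e |: p) :\: (e |: hist st) ->
    [/\ x != e, x \notin e |: hist st & x \in p :\: hist st].
  by rewrite !inE negb_or; case: eqVneq => //= xe /andP[-> ->].
split => //=.
- exact: setUS.
- by move=> x; rewrite /w /update; case: ifP; rewrite ?marginal_ge0.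
- move=> A sA; have [eA|eA] := boolP (e \in A); last first.
    rewrite update_sum // wA //; apply/subsetP => x xA.
    have := subsetP sA x xA; rewrite !inE => /orP[/eqP xe|//].
    by rewrite -xe xA in eA.
  have sAH : A :\ e \subset hist st by rewrite subDset.
  rewrite (big_setD1 _ eA) /= update_sum ?inE ?eqxx //.
  rewrite {1}/w /update eqxx.
  have := marginal1_antimono fS sAH eH; rewrite -/m /marginal setD1K //.
  by have := wA _ sAH; lra.
- move: HS wS1; rewrite /m /marginal; lra.
- move=> x /rejP[xe xeH xpH]; rewrite wE //; apply: le_trans (marg _ xpH).
  by apply: marginal1_antimono => //; exact: subsetUr.
- move=> x /rejP[xe xeH xpH]; have [|sp] := rej x xpH; rewrite /rejected_by wE //.
    by left.
  right=> t /sp; apply: spanned_trans.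
  - exact: indep_subset (level_subset _ _ _) iS.
  - exact: indep_subset (level_subset _ _ _) iS1.
  - exact: sp1.
Qed.

Lemma argmin_setP w A : match tb (argmin_set w A) with
  | Some y => y \in A /\ forall z, z \in A -> w y <= w z
  | None => A = set0
  end.
Proof.
have := tbP (argmin_set w A); case: (tb _) => [y|/eqP E].
  by rewrite inE => /andP[yA /forall_inP].
have [//|[a aA]] := set_0Vmem A.
have [b bA bmin] : exists2 b, b \in A & {in A, forall x, w b <= w x}.
  by case: (arg_minP w aA) => b bA bmin; exists b.
suff : b \in argmin_set w A by rewrite E inE.
by rewrite inE bA; apply/forall_inP.
Qed.

Lemma invariant_step p st e : invariant p st -> e \notin p ->
  invariant (e |: p) (step f M tb k eps tau st e).
Proof.
move=> inv ep; have [iS sSH sHp w0 _ _ _ _] := inv.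
have eH : e \notin hist st by apply: contra ep; exact: subsetP.
have eS : e \notin sol st by apply: contra eH; exact: subsetP.
rewrite /step -/(update (wgt st) e (marginal f [set e] (hist st))).
set m := marginal _ _ _; set w := update _ _ _; cbv zeta.
have we : w e = m by rewrite /w /update eqxx.
have wE x : x != e -> w x = wgt st x by rewrite /w /update => /negbTE ->.
have m0 : 0 <= m by exact: marginal_ge0.
have wS : \sum_(x in sol st) w x = \sum_(x in sol st) wgt st x by exact: update_sum.
have spanS t S : {in sol st, forall x, x \in S} ->
    forall x, x \in level (wgt st) (sol st) t -> spanned M (level w S t) x.
  move=> sS x; rewrite inE => /andP[xS tx]; rewrite /spanned inE sS //=.
  by rewrite wE ?tx //; apply: contraNneq eS => <-.
case: ifPn => [lt_thr|_]; first by apply: invariant_reject => //; left.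
case: ifPn => [iU|dU].
  apply: invariant_accept => //; first exact: setUS.
    by rewrite big_setU1 //= -/w -/m wS we; lra.
  by move=> t; apply: spanS => x xS; rewrite !inE xS orbT.
have dep t : swap_candidates M (sol st) e \subset level w (sol st) t ->
    e |: level w (sol st) t \notin indep M.
  by apply: swap_candidates_spanned => //; exact: level_subset.
have := argmin_setP w (swap_candidates M (sol st) e).
case: (tb _) => [y [yC ymin]|C0]; last first.
  (* Without candidates every level set, even an empty one, spans [e]. *)
  apply: invariant_reject => //; right=> t _.
  by rewrite /spanned dep ?orbT // C0 sub0set.
have sub t : t <= w y -> swap_candidates M (sol st) e \subset level w (sol st) t.
  move=> tw; apply/subsetP => z zC; have := zC; rewrite !inE => /andP[-> _] /=.
  exact: le_trans tw (ymin _ zC).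
have [yS iU] : y \in sol st /\ e |: (sol st :\ y) \in indep M.
  by move: yC; rewrite inE => /andP[].
have ye : y != e by apply: contraNneq eS => <-.
have wy : w y = wgt st y by exact: wE.
rewrite -[if y == e then _ else _]/(w y) -[if e == e then _ else _]/(w e).
case: ifPn => [lt2|]; last first.
  (* From [2 * t <= w e <= 2 * w y] follows [t <= w y], so by minimality of [y] the level set at [t]
     contains all candidates. *)
  rewrite -leNgt => le2; apply: invariant_reject => //; right=> t.
  by rewrite -/m -/w we => le_t; rewrite /spanned dep ?orbT // sub //;
    move: le2; rewrite we; lra.
apply: invariant_accept => //; rewrite -/m -/w.
- by apply: setUS; apply: subset_trans sSH; exact: subD1set.
(* The solution gains weight [m - w y], and twice that is at least [m] because [2 * w y < m]. *)
- rewrite big_setU1 /= ?we; last by rewrite !inE (negbTE eS) andbF.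
  move: wS; rewrite (big_setD1 _ yS) /=; move: lt2; rewrite we; lra.
move=> t x xI; have := xI; rewrite inE => /andP[xS tx].
have xe : x != e by apply: contraNneq eS => <-.
have [xy|xy] := eqVneq x y; last first.
  by rewrite /spanned !inE xy xS (negbTE xe) wE //= tx.
rewrite xy; rewrite xy -wy in tx.
(* All candidates weigh at least [t], so [e] and the level set of the old
   solution already contain the circuit broken by the swap. *)
rewrite /spanned; apply/orP; right; apply: contra (dep t (sub t tx)).
apply: indep_subset; apply/subsetP => z; rewrite !inE.
have twe : t <= w e by move: (w0 y) lt2 tx; rewrite -wy; lra.
case: (eqVneq z e) => [->|ze] /=; first by rewrite twe orbT.
by case: (eqVneq z y).
Qed.

Lemma invariant_foldl s p st : uniq s -> {in s, forall x, x \notin p} ->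
  invariant p st ->
  invariant ([set x in s] :|: p) (foldl (step f M tb k eps tau) st s).
Proof.
elim: s p st => [|e s IH] p st /=; first by rewrite set_nil set0U.
move=> /andP[es us] sp inv.
rewrite (_ : _ :|: p = [set x in s] :|: (e |: p)); last first.
  by apply/setP => x; rewrite !inE orbCA orbA.
apply: IH => //; last by apply: invariant_step => //; apply: sp; rewrite inE eqxx.
move=> x xs; rewrite !inE negb_or sp ?inE ?xs ?orbT // andbT.
by apply: contraNneq es => <-.
Qed.

(** * Comparison with one independent set, then the theorem *)

Lemma sum_threshold_rejected (w : V -> R) A a : (forall x, 0 <= w x) ->
  0 <= eps -> (#|A| <= k)%N -> 0 <= a -> tau <= a ->
  {in A, forall x, w x < eps / k%:R * tau} ->
  \sum_(x in A) w x <= eps * a.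
Proof.
move=> w0 e0 cA a0 ta wA; have [->|[x xA]] := set_0Vmem A.
  by rewrite big_set0 mulr_ge0.
have k0 : (0 < k)%N by apply: leq_trans cA; apply/card_gt0P; exists x.
(* [tau] may be negative, but a cutoff exceeding some nonnegative weight is not. *)
have c0 : 0 <= eps / k%:R * tau by apply: le_trans (w0 x) (ltW (wA x xA)).
apply: (@le_trans _ _ (\sum_(x in A) eps / k%:R * tau)).
  by apply: ler_sum => y yA; exact: ltW (wA y yA).
rewrite sumr_const -[leLHS]mulr_natl; apply: (@le_trans _ _ (k%:R * (eps / k%:R * tau))).
  by rewrite ler_wpM2r // ler_nat.
rewrite mulrA mulrCA divff ?mulr1 ?pnatr_eq0 -?lt0n //.
exact: ler_wpM2l.
Qed.

Lemma threshold_swapping_bound s O : mrank M = k -> uniq s -> 0 <= eps ->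
  O \in indep M -> O \subset [set x in s] -> forall a, 0 <= a -> tau <= a ->
  f O <= 4 * f (threshold_swapping f M tb k eps tau s) + eps * a.
Proof.
move=> kE us e0 iO sO a a0 ta; rewrite /threshold_swapping.
have : invariant ([set x in s] :|: set0)
    (foldl (step f M tb k eps tau) (init_state R V) s).
  by apply: invariant_foldl invariant_init => // x _; rewrite inE.
rewrite setU0; case: (foldl _ _ _) => S H w [/= iS sSH sHp w0 wA HS marg rej].
pose T := [set x in O :\: H | w x < eps / k%:R * tau].
pose Q := [set x in O :\: H | ~~ (w x < eps / k%:R * tau)].
have sOH x : x \in O :\: H -> x \in [set x in s] :\: H.
  by rewrite !inE => /andP[-> /(subsetP sO)]; rewrite inE.
have sumE : \sum_(x in O :\: H) w x = \sum_(x in T) w x + \sum_(x in Q) w x.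
  rewrite (bigID (fun x => w x < eps / k%:R * tau)) /=; congr (_ + _);
    by apply: eq_bigl => x; rewrite !inE.
have sumT : \sum_(x in T) w x <= eps * a.
  apply: sum_threshold_rejected => // [|x]; last by rewrite inE => /andP[].
  rewrite -kE; apply: indep_card_le_mrank; apply: indep_subset iO.
  by apply/subsetP => x; rewrite !inE => /andP[/andP[]].
have sumQ : \sum_(x in Q) w x <= 2 * \sum_(x in S) w x.
  rewrite mulr_sumr; apply: sum_le_of_level_card => [x _|t].
    by rewrite mulr_ge0.
  (* Doubling the weights turns level [t] into level [t / 2] of [w], which spans the elements of [Q]
     of weight at least [t]. *)
  have -> : [set x in S | t <= 2 * w x] = level w S (t / 2).
    by apply/setP => x; rewrite !inE ler_pdivrMr // mulrC.
  apply: (spanned_card (M := M)).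
  - by apply: indep_subset iO; apply/subsetP => x; rewrite !inE => /andP[/andP[/andP[]]].
  - exact: indep_subset (level_subset _ _ _) iS.
  move=> x; rewrite inE => /andP[]; rewrite inE => /andP[xOH /negP xthr] tx.
  have [//|] := rej x (sOH x xOH); apply.
  by rewrite mulrC divfK.
have sumO : f O <= f H + \sum_(x in O :\: H) w x.
  apply: (@le_trans _ _ (f ((O :\: H) :|: H))).
    by apply: fM; apply/subsetP => x xO; rewrite !inE xO andbT orNb.
  apply: le_trans (setU_le_sum_marginal fM fS _ _) _.
  by rewrite lerD2l; apply: ler_sum => x /sOH; exact: marg.
have := wA S sSH; move: sumO HS; rewrite sumE; move: sumT sumQ; lra.
Qed.

End Algorithm.

Theorem theorem15 (R : realType) :
  exists2 g : R -> R, g =O_ (at_right 0) (fun eps : R => eps) &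
    forall (V : finType) (f : {set V} -> R) (M : matroid V) (k : nat)
           (tb : {set V} -> option V) (s : seq V) (eps tau : R),
      set_nonnegative f -> set_monotone f -> set_normalized f ->
      submodular f ->
      mrank M = k ->
      tie_breaking tb ->
      uniq s ->
      0 < eps < 1 ->
      tau < opt f M s ->
      opt f M s <=
        (4 + g eps) * f (threshold_swapping f M tb k eps tau s).
Proof.
exists (fun eps => 4 * eps / (1 - eps)).
  (* For [e < 1 / 2] the denominator exceeds [1 / 2], whence the constant 8. *)
  apply/eqO_exP; exists 8 => //; near=> e.
  have e0 : 0 < e by near: e; exact: nbhs_right_gt.
  have e2 : e < 1 / 2 by near: e; apply: nbhs_right_lt; lra.
  rewrite !ger0_norm ?(ltW e0) //; last by rewrite divr_ge0 //; lra.
  by rewrite ler_pdivrMr; [nra | lra].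
move=> V f M k tb s eps tau fge0 fM f0 fS kE tbP us /andP[e0 e1] lt_tau.
set S := threshold_swapping _ _ _ _ _ _ _.
have opt0 : 0 <= opt f M s.
  by rewrite -f0 /opt; exact: bigmax_ge_id.
have le4 : opt f M s <= 4 * f S + eps * opt f M s.
  (* The first goal concerns the default value [f set0], which is 0. *)
  rewrite {1}/opt; apply: bigmax_le => [|A /andP[iA sA]].
    by rewrite f0 addr_ge0 ?mulr_ge0 ?(ltW e0).
  by apply: threshold_swapping_bound; rewrite ?(ltW e0) // ltW.
have -> : 4 + 4 * eps / (1 - eps) = 4 / (1 - eps).
  by field; rewrite subr_eq0 gt_eqF.
by rewrite mulrAC ler_pdivlMr; [lra | lra].
Unshelve. all: by end_near.
Qed.
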